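(* Let $1\le l\le m\le n$ be integers and let $1\le k\le n-l+1$. The number of parking functions $\pi\in\mathrm{PF}(m,n)$ with $\pi_1=k,\ \pi_2=k+1,\ \dots,\ \pi_l=k+l-1$ is $$(n-m+1)\sum_{s=0}^{\min(n-k-l+1,\,m-l)}\binom{m-l}{s}(n-s+1-l)^{m-s-l-1}\,l\,(s+l)^{s-1}.$$ Moreover, this quantity is constant in $k$ for $k\le n-m+1$ and decreases as $k$ increases past $n-m+1$.
   Context: Write $[n]=\{1,\dots,n\}$. For integers $0\le m\le n$, $\mathrm{PF}(m,n)$ denotes the set of parking functions with $m$ cars and $n$ spots: sequences $(\pi_1,\dots,\pi_m)\in[n]^m$ such that, when cars $1,\dots,m$ enter in order a one-way street with spots $1,\dots,n$ and car $i$ parks in spot $\pi_i$ if it is free and otherwise in the first free spot after $\pi_i$, all cars park. Equivalently, the non-decreasing rearrangement $(\lambda_1,\dots,\lambda_m)$ satisfies $\lambda_i\le n-m+i$ for all $i$. Powers with exponent $-1$ are taken in $\mathbb Q$. *)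

(* Defs.v *)
From HB Require Import structures.
From mathcomp Require Import all_boot all_order all_algebra.

Set Implicit Arguments.
Unset Strict Implicit.
Unset Printing Implicit Defensive.

Import Order.TTheory GRing.Theory Num.Theory.

(* Spots and cars are numbered from 0: the ordinal [j : 'I_n] is the spot
   j + 1, and [tnth pi i] is the preference of car i + 1. *)

(* [enum 'I_n] is increasing, so this is the first free spot at or after [p]. *)
Definition parking_spot (n : nat) (occ : {set 'I_n}) (p : 'I_n) : option 'I_n :=
  ohead [seq j : 'I_n <- enum 'I_n | (p <= j) && (j \notin occ)].

Fixpoint all_park (n : nat) (occ : {set 'I_n}) (s : seq 'I_n) : bool :=
  if s is p :: s' then
    if parking_spot occ p is Some j then all_park (j |: occ) s' else false
  else true.

Definition PF (m n : nat) : {set m.-tuple 'I_n} :=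
  [set pi : m.-tuple 'I_n | all_park set0 pi].

(* In 1-based terms: pi_1 = k, pi_2 = k + 1, ..., pi_l = k + l - 1. *)
Definition PF_run (m n l k : nat) : {set m.-tuple 'I_n} :=
  [set pi in PF m n |
    [forall i : 'I_m, (i < l) ==> ((tnth pi i).+1 == k + i)]].

(* Main.v *)
Require Import Defs.
From mathcomp Require Import all_boot all_order all_algebra.
From mathcomp Require Import zify ring.

Set Implicit Arguments.
Unset Strict Implicit.
Unset Printing Implicit Defensive.

Import Order.TTheory GRing.Theory Num.Theory.

(** A word is a parking function with n spots iff, for every j, at most n - j of
    its letters are >= j (letters and spots numbered from 0).  Let f(k) be the
    number of parking functions whose first l entries are the run k, ..., k+l-1.
    Moving the run one step to the right changes the condition only at j = k+1,
    so f(k) - f(k+1) counts the words for which that condition is tight: exactly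
    s = n-k-l of the other letters exceed k.  Those s letters then form a parking
    function in PF(s, n-k-1), the remaining ones form one in PF(m-l-s, k), and the
    two are shuffled arbitrarily, hence
      f(k) - f(k+1) = C(m-l, s) |PF(m-l-s, k)| |PF(s, n-k-1)|.
    Since f(n-l+1) = 0, summing gives the formula, given
    |PF(m, n)| = (n-m+1)(n+1)^(m-1), which follows by induction on n and the
    binomial theorem after splitting off the cars that prefer spot 0. *)

(** * Counting words over a finite alphabet *)

(** Letters are plain naturals, so that words over alphabets of different sizes can be filtered,
    shifted and compared without casts between ordinal types. *)
Fixpoint nwords (n r : nat) (P : pred (seq nat)) : nat :=
  if r is r'.+1 then \sum_(0 <= x < n) nwords n r' (fun w => P (x :: w))
  else P [::].

Lemma eq_nwords n r (P Q : pred (seq nat)) :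
  (forall w, size w = r -> all (gtn n) w -> P w = Q w) ->
  nwords n r P = nwords n r Q.
Proof.
elim: r P Q => [|r IH] P Q PQ /=; first by rewrite PQ.
rewrite !big_mkord; apply: eq_bigr => x _; apply: IH => w sw nw.
by apply: PQ => /=; [rewrite sw | rewrite ltn_ord].
Qed.

Lemma nwords0 n r : nwords n r pred0 = 0.
Proof. by elim: r => //= r IH; rewrite big1. Qed.

Lemma nwords1 r : nwords 1 r predT = 1.
Proof. by elim: r => //= r IH; rewrite big_nat1. Qed.

Lemma nwordsU n r (P Q : pred (seq nat)) :
  (forall w, P w -> ~~ Q w) ->
  nwords n r (fun w => P w || Q w) = nwords n r P + nwords n r Q.
Proof.
elim: r P Q => [|r IH] P Q PQ /=.
  by case: (P [::]) (PQ [::]) => [/(_ isT)/negPf->|_].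
rewrite -big_split /=; apply: eq_bigr => x _.
by apply: IH => w; apply: PQ.
Qed.

Lemma nwords_partition n r (P : pred (seq nat)) (f : seq nat -> nat) b :
  (forall w, size w = r -> f w < b) ->
  nwords n r P = \sum_(0 <= t < b) nwords n r (fun w => (f w == t) && P w).
Proof.
elim: r P f => [|r IH] P f fb /=.
  rewrite (bigD1_seq (f [::])) ?iota_uniq ?mem_iota ?add0n ?subn0 ?fb //=.
  by rewrite eqxx big1 ?addn0 // => i; rewrite eq_sym => /negPf->.
rewrite exchange_big /=; apply: eq_bigr => x _.
by apply: IH => w sw; apply: fb; rewrite /= sw.
Qed.

Lemma nwords_prefix n u r (P : pred (seq nat)) :
  all (gtn n) u ->
  nwords n (size u + r) (fun w => (take (size u) w == u) && P w) =
  nwords n r (fun w => P (u ++ w)).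
Proof.
elim: u P => [|y u IH] P /=; first by move=> _; apply: eq_nwords => w; rewrite take0.
case/andP=> ny nu; rewrite -(IH (fun w => P (y :: w))) //.
rewrite (bigD1_seq y) ?iota_uniq ?mem_iota ?subn0 //=.
rewrite [X in _ + X]big1 ?addn0.
  by apply: eq_nwords => w _ _; rewrite eqseq_cons eqxx.
move=> x /negPf xy; rewrite -[RHS](nwords0 n (size u + r)).
by apply: eq_nwords => w _ _; rewrite eqseq_cons xy.
Qed.

Lemma nwords_drop_letter n r (P : pred (seq nat)) :
  (forall w, P w -> n \notin w) -> nwords n.+1 r P = nwords n r P.
Proof.
elim: r P => //= r IH P Pn; rewrite big_nat_recr //= [X in _ + X](_ : _ = 0).
  rewrite addn0; apply: eq_bigr => x _; apply: IH => w /Pn.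
  by rewrite inE negb_or => /andP[].
rewrite -(nwords0 n.+1 r); apply: eq_nwords => w _ _.
by apply/negP => /Pn; rewrite mem_head.
Qed.

(** The binomial chooses the positions of the letters that are at least [a]. In the induction on the
    length, a first letter below [a] and one above give the two terms of Pascal's rule. *)
Lemma nwords_split a b r s (P Q : pred (seq nat)) :
  nwords (a + b) r (fun w => [&& count (leq a) w == s,
    P [seq x <- w | x < a] & Q [seq x - a | x <- w & a <= x]]) =
  'C(r, s) * (nwords a (r - s) P * nwords b s Q).
Proof.
elim: r s P Q => [|r IH] s P Q /=.
  by case: s => [|s] /=; rewrite ?bin0n ?mul1n ?mul0n //; case: (P _); case: (Q _).
rewrite (big_cat_nat (n := a)) //= ?leq_addr //.
have -> : \sum_(0 <= x < a) nwords (a + b) r (fun w =>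
    [&& (a <= x) + count (leq a) w == s,
     P (if x < a then x :: [seq x <- w | x < a] else [seq x <- w | x < a]) &
     Q [seq x - a | x <- if a <= x then x :: [seq x <- w | a <= x]
                         else [seq x <- w | a <= x]]]) =
  'C(r, s) * (nwords a (r.+1 - s) P * nwords b s Q).
  have [sr|rs] := leqP s r; last first.
    rewrite bin_small // mul0n big_nat big1 // => x /andP[_ xa].
    rewrite xa leqNgt xa /= (IH s (fun w => P (x :: w)) Q) bin_small //.
  rewrite subSn //= big_distrl big_distrr /= !big_nat.
  apply: eq_bigr => x /andP[_ xa].
  by rewrite xa leqNgt xa /= (IH s (fun w => P (x :: w)) Q).
rewrite -[X in _ + \sum_(X <= _ < _) _]add0n big_addn addKn.
case: s => [|s].
  rewrite [X in _ + X]big1 ?addn0 ?bin0 // => x _.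
  by rewrite leq_addl -[RHS](nwords0 (a + b) r); apply: eq_nwords => w.
rewrite binS mulnDl subSS; congr (_ + _).
rewrite /= big_distrr big_distrr /=; apply: eq_bigr => x _.
rewrite leq_addl ltnNge leq_addl /=.
rewrite -(IH s P (fun w => Q (x :: w))).
by apply: eq_nwords => w _ _; rewrite addnK.
Qed.

(** * The parking rule as a counting condition *)

(** The condition at [j = 0] bounds the length by [n], and the one at [j = n] excludes letters
    outside the street. *)
Definition parkable (n : nat) (w : seq nat) : bool :=
  all (fun j => count (leq j) w <= n - j) (iota 0 n.+1).

Lemma parkableP n w :
  reflect (forall j, j <= n -> count (leq j) w <= n - j) (parkable n w).
Proof.
apply: (iffP allP) => H j; first by move=> jn; apply: H; rewrite mem_iota.
by rewrite mem_iota add0n ltnS => /andP[_]; apply: H.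
Qed.

Lemma card_tuple_nwords n r (P : pred (seq nat)) :
  #|[set t : r.-tuple 'I_n | P (map (@nat_of_ord n) t)]| = nwords n r P.
Proof.
elim: r P => [|r IH] P /=.
  rewrite -sum1dep_card big_mkcond (big_pred1 [tuple]) /=; first by case: (P _).
  by move=> t; apply/esym/eqP/val_inj; rewrite (tuple0 t).
rewrite big_mkord -sum1dep_card big_mkcond /=.
pose h (p : 'I_n * r.-tuple 'I_n) := [tuple of p.1 :: p.2].
rewrite (reindex h) /=; last first.
  exists (fun t => (thead t, [tuple of behead t])) => [[x t] _|t _].
    by congr (_, _); apply: val_inj.
  by rewrite /h /= -tuple_eta.
rewrite -(pair_bigA _ (fun x t =>
  if P (map (@nat_of_ord n) (h (x, t))) then 1 else 0)) /=.
by apply: eq_bigr => x _; rewrite -IH -sum1dep_card -big_mkcond.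
Qed.

Lemma parking_spotP n (occ : {set 'I_n}) (p : 'I_n) :
  match parking_spot occ p with
  | Some q => [/\ p <= q, q \notin occ &
                forall j : 'I_n, p <= j -> j < q -> j \in occ]
  | None => forall j : 'I_n, p <= j -> j \in occ
  end.
Proof.
rewrite /parking_spot.
set s := filter _ _.
have sE (j : 'I_n) : (j \in s) = (p <= j) && (j \notin occ).
  by rewrite mem_filter mem_enum andbT.
have : sorted ltn (map val s).
  apply: (@subseq_sorted _ ltn ltn_trans _ (map val (enum 'I_n))).
    exact/map_subseq/filter_subseq.
  by rewrite val_enum_ord iota_ltn_sorted.
case: s sE => [|q s] sE /=.
  by move=> _ j pj; move: (sE j); rewrite in_nil pj /=; case: (j \in occ).
rewrite (path_sortedE ltn_trans) => /andP[/allP qs _].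
move: (sE q); rewrite mem_head => /esym/andP[pq qocc]; split=> // j pj jq.
apply: contraTT jq => jocc; rewrite -leqNgt.
move: (sE j); rewrite pj jocc /= inE => /orP[/eqP->//|js].
by apply/ltnW/qs/map_f.
Qed.

Lemma perm_enumU1 (T : finType) (x : T) (A : {set T}) :
  x \notin A -> perm_eq (enum (x |: A)) (x :: enum A).
Proof.
move=> xA; apply: uniq_perm; rewrite ?enum_uniq //= ?mem_enum ?xA ?enum_uniq //.
by move=> y; rewrite mem_enum !inE mem_enum.
Qed.

Section OccupiedSpots.
Variables (n : nat) (occ : {set 'I_n}).

Lemma count_leq_occS (i : 'I_n) :
  count (leq i) (map (@nat_of_ord n) (enum occ)) =
  (i \in occ) + count (leq i.+1) (map (@nat_of_ord n) (enum occ)).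
Proof.
rewrite -mem_enum -(mem_map (@ord_inj n)) -count_uniq_mem; last first.
  by rewrite (map_inj_uniq (@ord_inj n)) enum_uniq.
elim: (map (@nat_of_ord n) (enum occ)) => //= x s ->.
by case: ltngtP => _ /=; lia.
Qed.

Lemma count_leq_occ_run (p j : nat) :
  p <= j <= n -> (forall i : 'I_n, p <= i -> i < j -> i \in occ) ->
  count (leq p) (map (@nat_of_ord n) (enum occ)) =
  (j - p) + count (leq j) (map (@nat_of_ord n) (enum occ)).
Proof.
case/andP; elim: j => [|j IH]; first by rewrite leqn0 => /eqP->.
rewrite leq_eqVlt => /predU1P[->|]; first by rewrite subnn.
rewrite ltnS => pj jn H.
rewrite IH ?(ltnW jn) // => [|i pi ij]; last by rewrite H // ltnW.
by rewrite (count_leq_occS (Ordinal jn)) H //= subSn // addnS.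
Qed.

End OccupiedSpots.

Lemma count_leq_occ_le n (occ : {set 'I_n}) j :
  j <= n -> count (leq j) (map (@nat_of_ord n) (enum occ)) <= n - j.
Proof.
move=> jn; rewrite -(addn0 (n - j)).
(* Comparison with the full set, which has exactly [n - j] spots from [j] on. *)
rewrite -(_ : count (leq n) (map (@nat_of_ord n) (enum [set: 'I_n])) = 0).
  rewrite -count_leq_occ_run ?jn ?leqnn // => [|i _ _]; last by rewrite inE.
  rewrite !count_map -!size_filter; apply: uniq_leq_size.
    by rewrite filter_uniq ?enum_uniq.
  by move=> x; rewrite mem_filter => /andP[jx _]; rewrite mem_filter jx mem_enum inE.
apply/eqP; rewrite -leqn0 leqNgt -has_count; apply/hasPn => x /mapP[i _ ->].
by rewrite -ltnNge /=.
Qed.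

(** Occupied spots count as extra letters. Parking a car with preference [p] in spot [q] replaces
    the letter [p] by [q], so the induction must show that this preserves the condition. *)
Lemma all_parkE n (occ : {set 'I_n}) (s : seq 'I_n) :
  all_park occ s =
  parkable n (map (@nat_of_ord n) s ++ map (@nat_of_ord n) (enum occ)).
Proof.
elim: s occ => [|p s IH] occ /=.
  by apply/esym/parkableP => j; apply: count_leq_occ_le.
pose cs j := count (leq j) (map (@nat_of_ord n) s).
pose co (A : {set 'I_n}) j := count (leq j) (map (@nat_of_ord n) (enum A)).
have cE j (A : {set 'I_n}) :
    count (leq j) (map (@nat_of_ord n) s ++ map (@nat_of_ord n) (enum A)) =
    cs j + co A j by rewrite count_cat.
have co_run j : p <= j <= n ->
    (forall i : 'I_n, p <= i -> i < j -> i \in occ) -> co occ p = (j - p) + co occ j.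
  exact: count_leq_occ_run.
have := parking_spotP occ p; case: parking_spot => [q [pq qocc pq_occ]|p_occ].
- have cU j : co (q |: occ) j = (j <= q) + co occ j.
    by rewrite /co !count_map (permP (perm_enumU1 qocc)).
  rewrite IH; apply/parkableP/parkableP => H j jn; have := H j jn;
    rewrite /= !cE cU; first by lia.
  (* Only [p < j <= q] matters. There the spots from [p] to [j - 1] are all occupied, so the bound
     at [p] implies the one at [j]. *)
  have [jp|pj] := leqP j p; first by lia.
  have [jq _|qj] := leqP j q; last by lia.
  have := H p (ltnW (ltn_ord p)); rewrite /= cE leqnn (co_run j) ?jn ?(ltnW pj) //.
    have : cs j <= cs p by apply: sub_count => x /=; apply: leq_trans (ltnW pj).
    by lia.
  by move=> i pi ij; apply: pq_occ => //; apply: leq_trans jq.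
(* All [n - p] spots from [p] on are taken, and the new car makes one letter too many. *)
- apply/esym/negP => /parkableP/(_ p (ltnW (ltn_ord p))).
  rewrite /= cE leqnn (co_run n) ?leqnn ?(ltnW (ltn_ord p)) //.
    by have := ltn_ord p; lia.
  by move=> i pi _; apply: p_occ.
Qed.

(** * Recursion for the number of parking functions *)

Definition nparkable (r n : nat) : nat := nwords n r (parkable n).

Lemma parkable_notin n w : parkable n w -> n \notin w.
Proof.
move/parkableP/(_ n (leqnn n)); rewrite subnn leqn0 -[_ == 0]negbK -lt0n -has_count.
by apply: contra => nw; apply/hasP; exists n.
Qed.

Lemma nparkable_gt r n : n < r -> nparkable r n = 0.
Proof.
move=> nr; rewrite -(nwords0 n r); apply: eq_nwords => w sw _.
apply/negP => /parkableP/(_ 0 isT).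
by rewrite (eq_count (a2 := predT)) // count_predT sw subn0 leqNgt nr.
Qed.

(** Here [t] is the number of cars that do not prefer spot 0. Lowered by 1, their preferences
    satisfy the same conditions with [n] spots, and the condition at 0 is the hypothesis
    [r <= n.+1]. *)
Lemma nparkableS r n : r <= n.+1 ->
  nparkable r n.+1 = \sum_(0 <= t < r.+1) 'C(r, t) * nparkable t n.
Proof.
move=> rn; rewrite /nparkable.
rewrite (@nwords_partition _ _ _ (count (leq 1)) r.+1); last first.
  by move=> w <-; rewrite ltnS count_size.
rewrite !big_nat; apply: eq_bigr => t /andP[_ tr].
transitivity ('C(r, t) * (nwords 1 (r - t) predT * nwords n t (parkable n))).
  rewrite -(nwords_split 1 n r t); apply: eq_nwords => w sw _.
  rewrite /=; congr (_ && _).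
  have cE j : count (leq j) [seq x - 1 | x <- w & 1 <= x] = count (leq j.+1) w.
    rewrite count_map count_filter; apply: eq_count => x /=.
    by case: x => [|x]; rewrite ?ltn0 ?andbF ?andbT ?subn1.
  apply/parkableP/parkableP => H j jn; first by rewrite cE -subSS; apply: H.
  case: j jn => [|j] jn; first by rewrite subn0 (leq_trans (count_size _ _)) // sw.
  by rewrite -cE subSS; apply: H.
by rewrite nwords1 mul1n.
Qed.

Lemma sum_bin_expn (a r : nat) :
  \sum_(0 <= t < r.+1) 'C(r, t) * a ^ t = a.+1 ^ r.
Proof.
rewrite -[a.+1]add1n expnDn big_mkord.
by apply: eq_bigr => i _; rewrite exp1n mul1n.
Qed.

(** The derivative in [a] of the previous identity, obtained by absorbing [t] into the binomial. *)
Lemma sum_bin_expn_deriv (a r : nat) :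
  \sum_(0 <= t < r.+1) 'C(r, t) * (t * a ^ t.-1) = r * a.+1 ^ r.-1.
Proof.
case: r => [|r]; first by rewrite big_nat1.
rewrite big_nat_recl //= muln0 add0n -sum_bin_expn big_distrr /=.
by apply: eq_bigr => t _; rewrite mulnCA mulnA -mul_bin_diag mulnA.
Qed.

Lemma count_leq_iota j k l : count (leq j) (iota k l) = minn l (k + l - j).
Proof.
elim: l k => [|l IH] k /=; first by rewrite min0n.
by rewrite IH; case: leqP; lia.
Qed.

(** * Words that begin with a run *)

Section FirstRun.
Variables (n l : nat).
Hypothesis l_gt0 : 0 < l.

Definition nruns (r k : nat) : nat :=
  nwords n r (fun w => parkable n (iota k l ++ w)).

(** Let [c j] count the letters of [w] that are at least [j]. For [k < j <= k + l] the run at [k]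
    requires [c j <= n - k - l], and the run at [k.+1] requires strict inequality. As [c] is
    non-increasing, [j = k.+1] decides. In the tight case, subtracting [c k.+1] from the conditions
    at [j <= k] leaves those of [parkable k]. *)
Lemma parkable_run_split k w : k + l <= n ->
  parkable n (iota k l ++ w) =
  parkable n (iota k.+1 l ++ w) ||
  [&& count (leq k.+1) w == n - k - l, parkable k [seq x <- w | x < k.+1] &
      parkable (n - k.+1) [seq x - k.+1 | x <- w & k.+1 <= x]].
Proof.
move=> kln; pose c j := count (leq j) w.
have c_mono i j : i <= j -> c j <= c i.
  by move=> ij; apply: sub_count => x /=; apply: leq_trans.
have low j : j <= k -> count (leq j) [seq x <- w | x < k.+1] + c k.+1 = c j.
  move=> jk; rewrite /c count_filter.
  by elim: (w) => //= x v <-; case: (leqP j x); case: (ltnP x k.+1); lia.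
have high j : count (leq j) [seq x - k.+1 | x <- w & k.+1 <= x] = c (k.+1 + j).
  by rewrite count_map count_filter; apply: eq_count => x /=; lia.
have runE i j : count (leq j) (iota i l ++ w) = minn l (i + l - j) + c j.
  by rewrite count_cat count_leq_iota.
apply/parkableP/orP =>
  [H|[/parkableP H|/and3P[/eqP ck /parkableP Hl /parkableP Hh]] j jn].
- have [ck|ck] := eqVneq (c k.+1) (n - k - l).
    right; rewrite /=; apply/andP; split; apply/parkableP => j jk.
      by have := H j; rewrite runE; have := low j jk; lia.
    by have := H (k.+1 + j); rewrite runE high; lia.
  left; apply/parkableP => j jn; rewrite runE.
  have := H j jn; have := H k.+1; rewrite !runE.
  have [jk|kj] := leqP j k.+1; last by have := c_mono k.+1 j (ltnW kj); lia.
  by have [->|/eqP] := eqVneq j k.+1; lia.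
- by have := H j jn; rewrite !runE; lia.
- rewrite runE; rewrite -/(c k.+1) in ck.
  have [jk|kj] := leqP j k.
    by have := Hl j jk; have := low j jk; lia.
  have := Hh (j - k.+1); rewrite high subnKC //.
  by have := c_mono _ _ kj; lia.
Qed.

Lemma nrunsS r k : k + l <= n ->
  nruns r k = nruns r k.+1 +
    'C(r, n - k - l) *
      (nparkable (r - (n - k - l)) k * nparkable (n - k - l) (n - k.+1)).
Proof.
move=> kln; have kn : k < n by lia.
(* The small letters range over [k.+1] values, but a parking function with [k] spots never uses the
   letter [k]. *)
rewrite /nruns /nparkable -(@nwords_drop_letter k); last exact: parkable_notin.
rewrite -nwords_split subnKC // -nwordsU => [|w /parkableP/(_ k.+1)]; last first.
  rewrite count_cat count_leq_iota => H.
  by apply/negP => /and3P[/eqP ck _ _]; lia.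
by apply: eq_nwords => w _ _; apply: parkable_run_split.
Qed.

Lemma nrunsE r k d : k + l + d = n.+1 ->
  nruns r k = \sum_(0 <= s < d)
    'C(r, s) * (nparkable (r - s) (n - l - s) * nparkable s (s + l - 1)).
Proof.
elim: d k => [|d IH] k kd.
  (* Now [k + l = n + 1]: the [l] letters of the run are at least [k], but only [n - k = l - 1] are
     allowed. *)
  rewrite big_geq // -(nwords0 n r); apply: eq_nwords => w _ _.
  apply/negP => /parkableP/(_ k); rewrite count_cat count_leq_iota; lia.
rewrite nrunsS; last by lia.
rewrite big_nat_recr //= -(IH k.+1); last by lia.
have -> : n - k - l = d by lia.
have -> : k = n - l - d by lia.
by have -> : n - (n - l - d).+1 = d + l - 1 by lia.
Qed.

Lemma card_PF_run r k : k + l <= n -> #|PF_run (l + r) n l k.+1| = nruns r k.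
Proof.
move=> kln; have iota_lt : all (gtn n) (iota k l).
  by apply/allP => x; rewrite mem_iota /=; lia.
rewrite /nruns -(nwords_prefix _ _ iota_lt) size_iota -card_tuple_nwords.
apply: eq_card => t; rewrite !inE all_parkE enum_set0 cats0 andbC; congr (_ && _).
have st : size (take l (map (@nat_of_ord n) t)) = l.
  by rewrite size_takel // size_map size_tuple leq_addr.
have tE (i : 'I_(l + r)) : i < l ->
    nth 0 (take l (map (@nat_of_ord n) t)) i = tnth t i.
  move=> il; rewrite nth_take // (nth_map (tnth t i)) ?size_tuple //.
  exact/congr1/esym/tnth_nth.
apply/forallP/eqP => [H|H i].
  apply: (@eq_from_nth _ 0); rewrite st ?size_iota // => i il.
  have ilr : i < l + r by rewrite ltn_addr.
  have := H (Ordinal ilr); rewrite il /= => /eqP.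
  by rewrite (tE (Ordinal ilr)) // nth_iota // addSn => -[].
by apply/implyP => il; rewrite -tE // H nth_iota.
Qed.

End FirstRun.

(** * Closed formulas and monotonicity in the start of the run *)

Local Open Scope ring_scope.

(** The case [r = n.+1], where both sides vanish, is included because the recursion for [n.+1] cars
    on [n.+1] spots reaches [t = n.+1] on [n] spots. *)
Lemma nparkableE (r n : nat) : (r <= n.+1)%N ->
  (nparkable r n)%:R = (n%:R + 1 - r%:R) * (n%:R + 1) ^ (r%:Z - 1) :> rat.
Proof.
elim: n r => [|n IH] r rn.
  by case: r rn => [|[|r]] // _; rewrite nparkable_gt // subrr mul0r.
have [rn1|] := leqP r n.+1; last first.
  move=> rn2; have -> : r = n.+2 by apply/eqP; rewrite eqn_leq rn.
  by rewrite nparkable_gt // -[n.+2%:R]natr1 subrr mul0r.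
have n1 : (n%:R + 1 : rat) != 0 by rewrite natr1 pnatr_eq0.
rewrite nparkableS // natr_sum.
(* Each term splits as (n+1)^t - t (n+1)^(t-1). At [t = 0] the factor [t] cancels the truncated
   exponent [t.-1]. *)
have -> : \sum_(0 <= t < r.+1) ('C(r, t) * nparkable t n)%:R =
   \sum_(0 <= t < r.+1) (('C(r, t) * n.+1 ^ t)%:R -
     ('C(r, t) * (t * n.+1 ^ t.-1))%:R) :> rat.
  rewrite !big_nat; apply: eq_bigr => t /andP[_ tr].
  rewrite !(natrM _ 'C(_, _)) -mulrBr (IH t (leq_trans (ltnSE tr) rn1)).
  congr (_ * _).
  rewrite natrM !natrX -natr1 mulrBl; case: t {tr} => [|t].
    by rewrite mul0r subr0 mul0r subr0 sub0r expr0 exprN1 mulfV.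
  by rewrite -[in t.+1%:Z]addn1 PoszD addrK -exprnP exprS.
rewrite sumrB -!natr_sum sum_bin_expn sum_bin_expn_deriv.
case: r {rn rn1} => [|r].
  by rewrite mul0n !subr0 sub0r exprN1 mulfV // natr1 pnatr_eq0.
rewrite -[in r.+1%:Z]addn1 PoszD addrK -exprnP /= expnS !natrM natrX.
by rewrite -[n.+2%:R]natr1 -[r.+1%:R]natr1; ring.
Qed.

Lemma nparkable_gt0 r n : (r <= n)%N -> (0 < nparkable r n)%N.
Proof.
move=> rn; rewrite -(ltr0n rat) nparkableE ?leqW // mulr_gt0 ?exprz_gt0 ?natr1 //.
by rewrite subr_gt0 ltr_nat.
Qed.

(** Terms with [s > r] have a zero binomial, so the sum no longer depends on [k] once
    [n - k - l >= r]. *)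
Lemma nruns_min n l r k : (0 < l)%N -> (l + r <= n)%N -> (k + l <= n)%N ->
  nruns n l r k = (\sum_(0 <= s < (minn (n - k - l) r).+1)
    'C(r, s) * (nparkable (r - s) (n - l - s) * nparkable s (s + l - 1)))%N.
Proof.
move=> l0 lrn kln; rewrite (@nrunsE n l l0 r k (n - k - l).+1); last by lia.
rewrite [LHS](big_cat_nat (n := (minn (n - k - l) r).+1)) //=; last by lia.
rewrite [X in (_ + X)%N]big_nat [X in (_ + X)%N]big1 ?addn0 // => s /andP[lo hi].
by rewrite bin_small //; lia.
Qed.

(** The hypothesis [n <= k + l + r] puts the index [n - k - l] within [r], so the term lost at every
    step to the right is positive. *)
Lemma nruns_lt n l r k k' : (0 < l)%N -> (l + r <= n <= k + l + r)%N ->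
  (k < k')%N -> (k' + l <= n)%N -> (nruns n l r k' < nruns n l r k)%N.
Proof.
move=> l0 /andP[lrn nkr]; elim: k' => // k' IH; rewrite ltnS => kk' k'n.
apply: (@leq_trans (nruns n l r k')); last first.
  by move: kk'; rewrite leq_eqVlt => /predU1P[->//|kk']; apply/ltnW/IH => //; lia.
rewrite [X in (_ < X)%N]nrunsS //; last by lia.
rewrite -[X in (X < _)%N]addn0 ltn_add2l !muln_gt0 bin_gt0.
rewrite !nparkable_gt0 ?andbT; lia.
Qed.

Theorem proposition2p7 (l m n : nat)
    (hl : (1 <= l)%N) (hlm : (l <= m)%N) (hmn : (m <= n)%N) :
  [/\ (forall k : nat, (1 <= k)%N -> (k <= n - l + 1)%N ->
         (#|PF_run m n l k|)%:R =
         (n%:R - m%:R + 1) *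
         \sum_(0 <= s < (minn (n + 1 - k - l) (m - l)).+1)
           ('C(m - l, s)%:R
            * (n%:R - s%:R + 1 - l%:R) ^ (m%:Z - s%:Z - l%:Z - 1)
            * l%:R
            * (s%:R + l%:R) ^ (s%:Z - 1)) :> rat),
      (forall k k' : nat,
         (1 <= k)%N -> (k <= n - m + 1)%N ->
         (1 <= k')%N -> (k' <= n - m + 1)%N ->
         #|PF_run m n l k| = #|PF_run m n l k'|) &
      (forall k k' : nat,
         (n - m + 1 <= k)%N -> (k < k')%N -> (k' <= n - l + 1)%N ->
         (#|PF_run m n l k'| < #|PF_run m n l k|)%N)].
Proof.
have [r mE] : exists r, m = (l + r)%N by exists (m - l)%N; rewrite subnKC.
rewrite {m hlm}mE in hmn *; move: hmn; rewrite addKn => lrn; split.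
- case=> // k _ kn; have kln : (k + l <= n)%N by lia.
  rewrite card_PF_run // nruns_min // natr_sum mulr_sumr.
  have -> : (n + 1 - k.+1 - l = n - k - l)%N by lia.
  rewrite !big_nat; apply: eq_bigr => s /andP[_ smin].
  have [sr sn] : (s <= r)%N /\ (l + s <= n)%N by lia.
  (* The linear factors are (n-l-s)+1-(r-s) = n-m+1, which is free of [s], and (s+l-1)+1-s = l. *)
  rewrite !natrM !nparkableE; [|lia..].
  have -> : (n - l - s)%:R + 1 = n%:R - s%:R + 1 - l%:R :> rat.
    by rewrite -subnDA natrB // natrD; ring.
  have -> : (s + l - 1)%:R + 1 = s%:R + l%:R :> rat.
    by rewrite natr1 -natrD; congr (_%:R); lia.
  have -> : (r - s)%N%:Z - 1 = (l + r)%N%:Z - s%:Z - l%:Z - 1 by lia.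
  by rewrite natrB // natrD; ring.
- case=> // k; case=> // k' _ kn _ k'n.
  rewrite !card_PF_run ?nruns_min //; try lia.
  (* Both minima equal [r]. *)
  by congr (\sum_(0 <= s < _.+1) _)%N; lia.
- case=> [|k]; first by rewrite addn1.
  case=> // k' kn kk' k'n; rewrite !card_PF_run ?nruns_lt //; lia.
Qed.
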